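(* Let $k \geq 2$ be an integer, let $n_1, \dots, n_k \in \mathbb{N}$, and let $\mathcal{A}_i \subseteq 2^{[n_i]}$ for each $i \in [k]$. If $\mathcal{A}_1, \dots, \mathcal{A}_k$ are cross-intersecting, then \[\prod_{i=1}^k |\mathcal{A}_i| \leq \prod_{i=1}^k 2^{n_i-1} = 2^{\left(\sum_{i=1}^k n_i \right) - k},\] and equality holds if $\mathcal{A}_i = \left\{A \in 2^{[n_i]} \colon 1 \in A\right\}$ for each $i \in [k]$.
   Context: $\mathbb{N} = \{1,2,\dots\}$ is the set of positive integers, $[n] = \{1,\dots,n\}$, and $2^X$ denotes the power set of a set $X$. A family is a set of sets; families may be empty and need not be distinct from one another. Families $\mathcal{A}_1, \dots, \mathcal{A}_k$ are cross-intersecting if for every $i, j \in [k]$ with $i \neq j$, we have $A \cap B \neq \emptyset$ for every $A \in \mathcal{A}_i$ and every $B \in \mathcal{A}_j$. *)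

(* Defs.v *)
(* MathComp with finmap.  Sets of positive integers are [{fset nat}], so that
   members of families on different ground sets can be intersected. *)
From mathcomp Require Import all_boot.
From mathcomp Require Import finmap.

Set Implicit Arguments.
Unset Strict Implicit.
Unset Printing Implicit Defensive.

Local Open Scope fset_scope.

Definition segment (n : nat) : {fset nat} := [fset x in iota 1 n].

Definition cross_intersecting (k : nat) (A : 'I_k -> {fset {fset nat}}) : Prop :=
  forall i j : 'I_k, i != j ->
  forall B C : {fset nat}, B \in A i -> C \in A j -> B `&` C != fset0.

Definition star (n : nat) : {fset {fset nat}} :=
  [fset B in fpowerset (segment n) | 1 \in B].

(* Main.v *)
Require Import Defs.
From mathcomp Require Import all_boot.
From mathcomp Require Import finmap.
From mathcomp Require Import zify.

(** The statement for k families follows from the one for two families.  Call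
    an index i large if |A_i| > 2^(n_i - 1).  The bound for two families says
    that |A_i| |A_j| <= 2^(n_i - 1) 2^(n_j - 1) for i <> j, so at most one index
    is large, and a large index can be paired with any other one; all remaining
    factors are individually bounded ([leq_prod_pairwise]).

    For two cross-intersecting families F on S and G on T with S included in T,
    each member B of F excludes from G every set (S \ B) u D with D included in
    T \ S, since such a set misses B.  These |F| 2^(|T| - |S|) excluded subsets
    of T are distinct, whence |F| 2^(|T| - |S|) + |G| <= 2^|T|
    ([leq_card_cross_pair]), and the inequality between the arithmetic and
    geometric means turns this bound on a sum into the required bound on a
    product ([leq_mul_cross_pair]).  Two initial segments are always nested,
    so this covers every pair of the given families.

    Equality for stars is factorwise, since the star of 1 in the subsets of [n]
    has exactly 2^(n - 1) members ([card_star]). *)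

Local Open Scope fset_scope.

(** * Two cross-intersecting families on nested ground sets *)

Section CrossPair.

Variables (K : choiceType) (S T : {fset K}) (F G : {fset {fset K}}).
Hypotheses (sST : S `<=` T) (sFS : F `<=` fpowerset S).
Hypotheses (sGT : G `<=` fpowerset T).
Hypothesis crossFG :
  forall B C : {fset K}, B \in F -> C \in G -> B `&` C != fset0.

(** The sets (S \ B) u D, for B in F and D included in T \ S, are subsets of T
    outside G.  They are pairwise distinct because their traces on S and on
    T \ S determine B and D. *)
Lemma leq_card_cross_pair : #|` F| * 2 ^ (#|` T| - #|` S|) + #|` G| <= 2 ^ #|` T|.
Proof.
pose excl (B D : {fset K}) := (S `\` B) `|` D.
pose s := [seq excl B D | B <- F, D <- fpowerset (T `\` S)].
have inFS B x : B \in F -> (x \in B) ==> (x \in S).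
  move=> /(fsubsetP sFS); rewrite fpowersetE => /fsubsetP sBS.
  by apply/implyP/sBS.
have inDT (D : {fset K}) x :
    D \in fpowerset (T `\` S) -> (x \in D) ==> (x \notin S) && (x \in T).
  by rewrite fpowersetE => /fsubsetP sD; rewrite -in_fsetD; apply/implyP/sD.
have uniq_s : uniq s.
  apply: allpairs_uniq; rewrite ?fset_uniq //.
  move=> _ _ /allpairsP[[B D] /= [FB TD ->]] /allpairsP[[B' D'] /= [FB' TD' ->]].
  move=> /fsetP eqBD; congr (_, _); apply/fsetP => x; have := eqBD x;
    rewrite !inE;
    move: (inFS _ x FB) (inFS _ x FB') (inDT _ x TD) (inDT _ x TD');
    by case: (x \in S); case: (x \in B); case: (x \in B');
       case: (x \in D); case: (x \in D').
have size_s : size s = #|` F| * 2 ^ (#|` T| - #|` S|).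
  by rewrite size_allpairs -(cardfsDS sST) -card_fpowerset.
rewrite -size_s -card_fpowerset -size_cat; apply: uniq_leq_size.
  rewrite cat_uniq uniq_s fset_uniq andbT /=.
  apply/hasPn => C GC; apply/allpairsP => -[[B D] /= [FB TD defC]].
  have /fset0Pn[x] := crossFG _ _ FB GC.
  rewrite defC !inE => /andP[Bx]; rewrite Bx /= => Dx.
  have /implyP/(_ Dx)/andP[/negP nSx _] := inDT _ x TD.
  by case: nSx; apply: (implyP (inFS _ x FB)).
move=> C; rewrite mem_cat => /orP[/allpairsP[[B D] /= [FB TD ->]]|]; last first.
  exact: (fsubsetP sGT).
rewrite fpowersetE; apply/fsubsetP => x; rewrite !inE => /orP[/andP[_]|].
  exact: (fsubsetP sST).
by move/(implyP (inDT _ x TD))/andP => [].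
Qed.

Lemma leq_mul_cross_pair : 0 < #|` S| ->
  #|` F| * #|` G| <= 2 ^ (#|` S| - 1) * 2 ^ (#|` T| - 1).
Proof.
move=> S_gt0; have leST := fsubset_leq_card sST.
set d := #|` T| - #|` S|.
have sum_le := leq_card_cross_pair.
(* The arithmetic-geometric mean inequality for the two summands leaves a common
   factor 4 * 2 ^ d on both sides. *)
rewrite -(@leq_pmul2l (4 * 2 ^ d)) ?muln_gt0 ?expn_gt0 //.
have -> : 4 * 2 ^ d * (#|` F| * #|` G|) = 4 * ((#|` F| * 2 ^ d) * #|` G|) by lia.
have -> : 4 * 2 ^ d * (2 ^ (#|` S| - 1) * 2 ^ (#|` T| - 1)) = (2 ^ #|` T|) ^ 2.
  rewrite -[4]/(2 ^ 2) -!expnD -expnM; congr (2 ^ _); rewrite /d; lia.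
by apply: leq_trans (nat_AGM2 _ _) _; rewrite leq_exp2r.
Qed.

End CrossPair.

(** * From pairs of factors to the whole product *)

(** At most one factor a i0 can exceed its bound b i0; pairing it with any other
    factor restores the inequality. *)
Lemma leq_prod_pairwise (I : finType) (a b : I -> nat) : 1 < #|I| ->
    (forall i j, i != j -> a i * a j <= b i * b j) ->
  \prod_i a i <= \prod_i b i.
Proof.
move=> cardI leab.
have [/existsP[i0 lt_i0]|/existsPn le_all] := boolP [exists i, b i < a i];
  last by apply: leq_prod => i _; rewrite leqNgt le_all.
have le_other j : j != i0 -> a j <= b j.
  move=> ne_ji0; rewrite -(@leq_pmul2l (a i0)); last exact: leq_ltn_trans lt_i0.
  apply: leq_trans (leab i0 j _) _; first by rewrite eq_sym.
  by rewrite leq_mul2r (ltnW lt_i0) orbT.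
have /card_gt0P[j] : 0 < #|predC1 i0| by rewrite cardC1; case: #|I| cardI => [|[]].
rewrite inE => ne_ji0.
rewrite (bigD1 i0) //= (bigD1 j) //= [leqRHS](bigD1 i0) //=.
rewrite [X in _ <= _ * X](bigD1 j) //= !mulnA.
apply: leq_mul; first by rewrite leab // eq_sym.
by apply: leq_prod => i /andP[ne_i _]; apply: le_other.
Qed.

(** * Initial segments and stars *)

Lemma card_segment n : #|` segment n| = n.
Proof. by rewrite card_fseq undup_id ?iota_uniq // size_iota. Qed.

Lemma in_segment n x : (x \in segment n) = (0 < x <= n).
Proof. by rewrite !inE mem_iota add1n ltnS. Qed.

Lemma segment_subset m n : m <= n -> segment m `<=` segment n.
Proof.
move=> le_mn; apply/fsubsetP => x; rewrite !in_segment => /andP[-> le_xm].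
exact: leq_trans le_mn.
Qed.

(** Removing 1 is a bijection from the star onto the subsets of the segment
    without 1. *)
Lemma card_star n : 0 < n -> #|` star n| = 2 ^ (n - 1).
Proof.
move=> n_gt0; have seg1 : 1 \in segment n by rewrite in_segment.
have -> : star n = [fset 1 |` B | B in fpowerset (segment n `\ 1)].
  apply/fsetP => C; rewrite !inE fpowersetE.
  apply/andP/imfsetP => [[sC C1]|[B /= sB ->]].
    by exists (C `\ 1); rewrite /= ?fsetD1K // fpowersetE fsetSD.
  move: sB; rewrite fpowersetE fsubsetD1 => /andP[sB _].
  by rewrite fset1U1 fsubUset fsub1set seg1.
rewrite card_in_imfset => [|B C /=]; last first.
  rewrite !fpowersetE !fsubsetD1 => /andP[_ nB] /andP[_ nC] eqBC.
  by rewrite -(fsetU1K nB) eqBC fsetU1K.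
have := cardfsD1 1 (segment n); rewrite seg1 card_segment add1n card_fpowerset.
by move=> {2}->; rewrite subn1.
Qed.

Theorem corollary1p3 (k : nat) (hk : 2 <= k)
    (n : 'I_k -> nat) (hn : forall i : 'I_k, 1 <= n i)
    (A : 'I_k -> {fset {fset nat}})
    (hA : forall i : 'I_k, A i `<=` fpowerset (segment (n i)))
    (hcross : cross_intersecting A) :
  [/\ \prod_(i < k) #|` A i| <= \prod_(i < k) 2 ^ (n i - 1),
      \prod_(i < k) 2 ^ (n i - 1) = 2 ^ ((\sum_(i < k) n i) - k)
    & (forall i : 'I_k, A i = star (n i)) ->
      \prod_(i < k) #|` A i| = \prod_(i < k) 2 ^ (n i - 1)].
Proof.
split.
- apply: leq_prod_pairwise => [|i j]; first by rewrite card_ord.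
  wlog le_ij : i j / n i <= n j => [wlog_ij|] ne_ij.
    have [/wlog_ij|/ltnW/wlog_ij] := leqP (n i) (n j); first exact.
    by rewrite mulnC [leqRHS]mulnC; apply; rewrite eq_sym.
  have := @leq_mul_cross_pair _ _ _ _ _ (segment_subset _ _ le_ij) (hA i) (hA j)
            (hcross i j ne_ij).
  by rewrite !card_segment; apply.
- rewrite -expn_sum sumnB => [|i _]; last exact: hn.
  by rewrite sum_nat_const card_ord muln1.
- by move=> defA; apply: eq_bigr => i _; rewrite defA card_star.
Qed.
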